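(* Let $\mu$ be an infinite cardinal. The following are equivalent: (1) There is a $\square^*_\mu$-sequence $\vec C$ such that $V'(\vec C)$ contains a club in $\mu^+$; (2) $\square^*_{<}(\mu^+)$ holds; (3) There is a special $\mu^+$-Aronszajn tree.
   Context: A $C$-sequence over $\kappa=\mu^+$ is $\vec C=\langle C_\delta\mid\delta<\kappa\rangle$, each $C_\delta$ a closed subset of $\delta$ with $\sup(C_\delta)=\sup(\delta)$. Weakly coherent: $|\{C_\delta\cap\epsilon\mid\delta<\kappa\}|<\kappa$ for every $\epsilon<\kappa$. A $\square^*_\mu$-sequence is a weakly coherent $C$-sequence over $\mu^+$ with $\mathrm{otp}(C_\delta)\le\mu$ for all $\delta$. $\mathrm{acc}(\kappa)$: nonzero limit ordinals below $\kappa$; $\mathrm{acc}(A)=\{\alpha\in A\mid\sup(A\cap\alpha)=\alpha>0\}$, $\mathrm{nacc}(A)=A\setminus\mathrm{acc}(A)$. $V'(\vec C)=\{\delta\in\mathrm{acc}(\kappa)\mid\forall\alpha\in(\delta,\kappa)\,[\sup(\mathrm{nacc}(C_\delta)\cap\mathrm{nacc}(C_\alpha))<\delta]\}$; $R(\vec C)=\{\delta\in\mathrm{acc}(\kappa)\mid\forall\alpha\in(\delta,\kappa)\,[\mathrm{otp}(C_\alpha\cap\delta)<\delta]\}$. $\square^*_{<}(\kappa)$ asserts there is a weakly coherent $C$-sequence $\vec C$ over $\kappa$ with $R(\vec C)$ containing a club. A $\kappa$-tree has height $\kappa$ and levels of size $<\kappa$; $\kappa$-Aronszajn: no chain of size $\kappa$;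 special: there is $f:T\to T$ with $f(x)<_Tx$ for non-minimal $x$ and each $f^{-1}\{z\}$ covered by fewer than $\kappa$ antichains. *)

(* Defs.v *)
(* Ordinals below kappa = mu^+ are modelled as the elements of
   a well-ordered type K whose order type is exactly mu^+ (see is_succ_card). *)
From Stdlib Require Import Classical.

Section Defs.
Context {K : Type} (lt : K -> K -> Prop).

Definition le (x y : K) : Prop := lt x y \/ x = y.

Definition is_wellorder : Prop :=
  (forall x, ~ lt x x) /\
  (forall x y z, lt x y -> lt y z -> lt x z) /\
  (forall x y, lt x y \/ x = y \/ lt y x) /\
  well_founded lt.

Definition injects_below {X : Type} (P : X -> Prop) (a : K) : Prop :=
  exists f : X -> K, (forall x, P x -> lt (f x) a) /\
    (forall x y, P x -> P y -> f x = f y -> x = y).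

(* K has order type mu^+, where mu = |mu0| is an infinite cardinal and mu0 is
   the ordinal mu (an initial ordinal). *)
Definition is_succ_card (mu0 : K) : Prop :=
  is_wellorder /\
  (exists f : nat -> K, (forall n, lt (f n) mu0) /\
      (forall n m, f n = f m -> n = m)) /\
  (forall a, lt a mu0 -> ~ injects_below (fun x => lt x mu0) a) /\
  (forall a, injects_below (fun x => lt x a) mu0) /\
  ~ injects_below (fun _ : K => True) mu0.

Definition limit_pt (A : K -> Prop) (b : K) : Prop :=
  (exists c, lt c b) /\
  (forall c, lt c b -> exists a, A a /\ lt c a /\ lt a b).

Definition acc (A : K -> Prop) (x : K) : Prop := A x /\ limit_pt A x.
Definition nacc (A : K -> Prop) (x : K) : Prop := A x /\ ~ limit_pt A x.
Definition acc_kappa (d : K) : Prop := limit_pt (fun _ => True) d.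

Definition otp_le (A : K -> Prop) (b : K) : Prop :=
  exists f : K -> K, (forall x, A x -> lt (f x) b) /\
    (forall x y, A x -> A y -> lt x y -> lt (f x) (f y)).

Definition is_Cseq (C : K -> K -> Prop) : Prop :=
  forall d,
    (forall x, C d x -> lt x d) /\
    (forall b, lt b d -> limit_pt (C d) b -> C d b) /\
    (forall b, lt b d -> exists c, C d c /\ le b c).

Definition weakly_coherent (C : K -> K -> Prop) : Prop :=
  forall e, exists a : K, exists en : K -> (K -> Prop),
    forall d, exists x, lt x a /\ (forall y, (C d y /\ lt y e) <-> en x y).

Definition square_star_seq (mu0 : K) (C : K -> K -> Prop) : Prop :=
  is_Cseq C /\ weakly_coherent C /\ (forall d, otp_le (C d) mu0).

Definition Vprime (C : K -> K -> Prop) (d : K) : Prop :=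
  acc_kappa d /\
  forall a, lt d a -> exists b, lt b d /\
    (forall x, nacc (C d) x -> nacc (C a) x -> le x b).

Definition Rset (C : K -> K -> Prop) (d : K) : Prop :=
  acc_kappa d /\
  forall a, lt d a -> exists b, lt b d /\ otp_le (fun x => C a x /\ lt x d) b.

Definition club (D : K -> Prop) : Prop :=
  (forall a, exists d, D d /\ le a d) /\ (forall b, limit_pt D b -> D b).

Definition contains_club (S : K -> Prop) : Prop :=
  exists D, club D /\ forall x, D x -> S x.

Definition square_star_lt : Prop :=
  exists C, is_Cseq C /\ weakly_coherent C /\ contains_club (Rset C).

(* Trees.  A kappa-tree (T, tlt) with its height function h : T -> K:
   tlt is a strict partial order, the predecessors of each t form a chain,
   and h maps the predecessors of t order-isomorphically onto h t.
   (Such h, if it exists, is the height function; it exists iff T is a tree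
   of height <= kappa.) *)
Definition is_kappa_tree {T : Type} (tlt : T -> T -> Prop) (h : T -> K) : Prop :=
  (forall x, ~ tlt x x) /\
  (forall x y z, tlt x y -> tlt y z -> tlt x z) /\
  (forall t x y, tlt x t -> tlt y t -> x = y \/ tlt x y \/ tlt y x) /\
  (forall s t, tlt s t -> lt (h s) (h t)) /\
  (forall t a, lt a (h t) -> exists s, tlt s t /\ h s = a) /\
  (forall a, exists t, h t = a) /\
  (forall a, exists b, injects_below (fun t => h t = a) b).

Definition is_chain {T : Type} (tlt : T -> T -> Prop) (B : T -> Prop) : Prop :=
  forall x y, B x -> B y -> x = y \/ tlt x y \/ tlt y x.

Definition aronszajn {T : Type} (tlt : T -> T -> Prop) : Prop :=
  forall B, is_chain tlt B ->
    ~ exists g : K -> T, (forall a, B (g a)) /\ (forall a b, g a = g b -> a = b).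

Definition special {T : Type} (tlt : T -> T -> Prop) : Prop :=
  exists f : T -> T,
    (forall x, (exists y, tlt y x) -> tlt (f x) x) /\
    (forall z, exists (b : K) (c : T -> K),
        forall x, f x = z -> lt (c x) b /\
          (forall y, f y = z -> c x = c y -> x <> y -> ~ tlt x y /\ ~ tlt y x)).

Definition exists_special_aronszajn : Prop :=
  exists (T : Type) (tlt : T -> T -> Prop) (h : T -> K),
    is_kappa_tree tlt h /\ aronszajn tlt /\ special tlt.

End Defs.

(* Main.v *)
(* (1) implies (2) because an order type at most mu is below every delta > mu.

   (2) implies (3): along the minimal walk from b down to x record the order types
   otp(C_(b_i) /\ x), coded as a single ordinal phi b x.  The function phi b is injective,
   weak coherence makes the restrictions of the phi b to [0, a] few, and for delta in a
   club all of phi b delta lie below delta; so in the tree of these restrictions a node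
   of height delta can be sent to its restriction at height phi b delta.

   (3) implies (1): specialness gives g : T -> mu injective on branches.  Call s < t a
   record of t if g s < g s' for all s < s' < t; the records of t are cofinal in t, g is
   increasing on them, and those below a node r < t are the records of r with g below a
   bound.  Tag every record of t with the supremum sigma of the values of g at the
   records of t, and let C_delta be the closure of the ordinals coding the tagged
   records of a node t of height delta.  If delta < alpha and the nodes have the same
   tag, then their common records are bounded below delta, whence the condition on V'. *)
Require Import Defs.
From Stdlib Require Import Classical ClassicalEpsilon FunctionalExtensionality.
From Stdlib Require Import PropExtensionality ProofIrrelevance.
From Stdlib Require Import Wellfounded Cantor.

Existing Class is_wellorder.

Declare Scope ord_scope.
Local Open Scope ord_scope.

(** * Choice and recursion along a well-founded relation *)

Lemma choice {X Y : Type} (R : X -> Y -> Prop) :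
  (forall x, exists y, R x y) -> exists f, forall x, R x (f x).
Proof.
  intro H.
  exists (fun x => proj1_sig (constructive_indefinite_description _ (H x))).
  intro x. exact (proj2_sig (constructive_indefinite_description _ (H x))).
Qed.

Lemma choice_on {X Y : Type} (P : X -> Prop) (R : X -> Y -> Prop) :
  inhabited Y -> (forall x, P x -> exists y, R x y) ->
  exists f, forall x, P x -> R x (f x).
Proof.
  intros [y0] H. apply (choice (fun x y => P x -> R x y)). intro x.
  destruct (classic (P x)) as [p|p].
  - destruct (H x p) as [y Hy]. now exists y.
  - now exists y0.
Qed.

(** Recursion in which the value at [x] is specified rather than computed: [S] consults earlier
    values only, so a choice function for [S] drives an ordinary fixed point. *)
Lemma wf_rec {X Y : Type} (R : X -> X -> Prop) (S : X -> (X -> Y) -> Y -> Prop) :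
  well_founded R -> inhabited Y ->
  (forall x u v y, (forall z, R z x -> u z = v z) -> S x u y -> S x v y) ->
  (forall x u, exists y, S x u y) ->
  exists G, forall x, S x G (G x).
Proof.
  intros wf [y0] Hext Hex.
  destruct (choice (fun (p : X * (X -> Y)) y => S (fst p) (snd p) y)) as [F HF].
  { intros [x u]. apply Hex. }
  (* The choice function takes total functions, so partial ones are padded with [y0]; [Hext] makes
     the padding harmless. *)
  pose (ext x (rec : forall z, R z x -> Y) z :=
    match excluded_middle_informative (R z x) with
    | left h => rec z h
    | right _ => y0
    end).
  pose (G := Fix wf (fun _ => Y) (fun x rec => F (x, ext x rec))).
  assert (HG : forall x, G x = F (x, ext x (fun z _ => G z))).
  { intro x. unfold G at 1. rewrite Fix_eq; [reflexivity|].
    intros x' f g Hfg. replace g with f; [reflexivity|].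
    extensionality z. extensionality h. apply Hfg. }
  exists G. intro x. rewrite HG.
  apply (Hext x (ext x (fun z _ => G z))); [|apply (HF (x, _))].
  intros z Hz. unfold ext.
  destruct (excluded_middle_informative (R z x)); [reflexivity|contradiction].
Qed.

(** * Injections between subsets *)

Definition inj {X Y : Type} (P : X -> Prop) (Q : Y -> Prop) : Prop :=
  exists f : X -> Y, (forall x, P x -> Q (f x)) /\
    (forall x y, P x -> P y -> f x = f y -> x = y).

Definition prod_set {X Y : Type} (P : X -> Prop) (Q : Y -> Prop) (p : X * Y) :=
  P (fst p) /\ Q (snd p).

Lemma inj_sub {X : Type} (P Q : X -> Prop) : (forall x, P x -> Q x) -> inj P Q.
Proof. intro H. exists (fun x => x). auto. Qed.

Lemma inj_trans {X Y Z : Type} (P : X -> Prop) (Q : Y -> Prop) (R : Z -> Prop) :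
  inj P Q -> inj Q R -> inj P R.
Proof.
  intros [f [f1 f2]] [g [g1 g2]]. exists (fun x => g (f x)). split; auto.
Qed.

Lemma inj_prod {X Y Z W : Type} (P : X -> Prop) (Q : Y -> Prop)
  (P' : Z -> Prop) (Q' : W -> Prop) :
  inj P P' -> inj Q Q' -> inj (prod_set P Q) (prod_set P' Q').
Proof.
  intros [f [f1 f2]] [g [g1 g2]]. exists (fun p => (f (fst p), g (snd p))).
  split.
  - intros [x y] [px qy]. split; cbn in *; auto.
  - intros [x y] [x' y'] [px qy] [px' qy'] e. cbn in *. injection e; intros.
    f_equal; auto.
Qed.

Lemma inj_image {X Y : Type} (P : X -> Prop) (f : X -> Y) :
  inhabited X -> inj (fun y => exists x, P x /\ f x = y) P.
Proof.
  intro i.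
  destruct (choice_on (fun y => exists x, P x /\ f x = y)
              (fun y x => P x /\ f x = y)) as [g Hg]; auto.
  exists g. split.
  - intros y Hy. apply (Hg y Hy).
  - intros y y' Hy Hy' e. destruct (Hg y Hy) as [_ <-], (Hg y' Hy') as [_ <-].
    now rewrite e.
Qed.

Lemma inj_prod_nat : inj (prod_set (fun _ : nat => True) (fun _ : nat => True))
  (fun _ : nat => True).
Proof.
  exists to_nat. split; [auto|]. intros x y _ _. apply to_nat_inj.
Qed.

(** * Basic facts about well-orders *)

Section WellOrder.
Context {K : Type} {lt : K -> K -> Prop} {WO : is_wellorder lt}.
Notation "x < y" := (lt x y) : ord_scope.
Notation "x <= y" := (le lt x y) : ord_scope.

Lemma lt_irr x : ~ x < x.
Proof. apply WO. Qed.
Lemma lt_trans x y z : x < y -> y < z -> x < z.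
Proof. apply WO. Qed.
Lemma lt_tri x y : x < y \/ x = y \/ y < x.
Proof. apply WO. Qed.
Lemma lt_wf : well_founded lt.
Proof. apply WO. Qed.
Lemma not_lt x y : ~ x < y -> y <= x.
Proof. unfold le. destruct (lt_tri x y) as [|[|]]; auto; tauto. Qed.
Lemma not_le x y : ~ x <= y -> y < x.
Proof. unfold le. destruct (lt_tri x y) as [|[|]]; auto; tauto. Qed.
Lemma lt_le_trans x y z : x < y -> y <= z -> x < z.
Proof. intros H [H'| <-]; [exact (lt_trans _ _ _ H H')|exact H]. Qed.
Lemma le_lt_trans x y z : x <= y -> y < z -> x < z.
Proof. intros [H| ->] H'; [exact (lt_trans _ _ _ H H')|exact H']. Qed.
Lemma le_trans x y z : x <= y -> y <= z -> x <= z.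
Proof. intros [H| ->] H'; [left; exact (lt_le_trans _ _ _ H H')|exact H']. Qed.

Lemma least (P : K -> Prop) :
  (exists x, P x) -> exists x, P x /\ forall y, P y -> x <= y.
Proof.
  intros [x Hx]. revert Hx. induction x as [x IH] using (well_founded_ind lt_wf).
  intro Hx. destruct (classic (exists y, P y /\ y < x)) as [[y [Hy l]]|N].
  - exact (IH y l Hy).
  - exists x. split; [exact Hx|]. intros y Hy. apply not_lt. intro. eauto.
Qed.
End WellOrder.

(* Decides goals over a linear order: negate, then saturate by transitivity. *)
Ltac ord_with R :=
  let A := lazymatch type of R with ?A -> _ => A end in
  let add H p := (let T := type of p in
    lazymatch goal with _ : T |- _ => fail | _ => pose proof p as H end) in
  intros; cbv beta in *; try (apply NNPP; intro);
  repeat match goal with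
  | H : ~ ~ _ |- _ => apply NNPP in H
  | H : _ /\ _ |- _ => destruct H
  | H : ~ R _ _ |- _ => apply not_lt in H
  | H : ~ le R _ _ |- _ => apply not_le in H
  | H : ~ @eq A ?x ?y |- _ => destruct (lt_tri x y) as [?|[?|?]]; [clear H|contradiction|clear H]
  | H : @eq A ?x ?y |- _ =>
      pose proof (or_intror H : le R x y);
      pose proof (or_intror (eq_sym H) : le R y x); clear H
  end;
  repeat match goal with
  | H1 : R ?a ?b, H2 : R ?b ?c |- _ => let H := fresh in add H (lt_trans a b c H1 H2)
  | H1 : R ?a ?b, H2 : le R ?b ?c |- _ => let H := fresh in add H (lt_le_trans a b c H1 H2)
  | H1 : le R ?a ?b, H2 : R ?b ?c |- _ => let H := fresh in add H (le_lt_trans a b c H1 H2)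
  | H1 : le R ?a ?b, H2 : le R ?b ?c |- _ => let H := fresh in add H (le_trans a b c H1 H2)
  end;
  solve [match goal with H : R ?x ?x |- _ => destruct (lt_irr x H) end | contradiction].

Ltac ord :=
  match goal with R : ?A -> ?A -> Prop |- _ =>
    let _ := constr:(_ : is_wellorder R) in ord_with R end.

(** * Collapsing a well-founded relation *)

Section Collapse.
Context {K : Type} {lt : K -> K -> Prop} {WO : is_wellorder lt}.
Notation "x < y" := (lt x y) : ord_scope.
Notation "x <= y" := (le lt x y) : ord_scope.

(** Mostowski collapse: [G p] is the least ordinal that is not a value at a predecessor of [p]. It
    exists because the predecessors of [p] are too few to exhaust [K]. *)
Lemma collapse {X : Type} (R : X -> X -> Prop) :
  well_founded R -> (forall x y z, R x y -> R y z -> R x z) ->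
  (forall p, ~ inj (fun _ : K => True) (fun q => R q p)) ->
  exists G : X -> K, (forall q p, R q p -> G q < G p) /\
    (forall p k, k < G p -> exists q, R q p /\ G q = k).
Proof.
  intros wf tr Hseg.
  destruct (classic (inhabited X)) as [iX|nX].
  2:{ exists (fun x => False_rect _ (nX (inhabits x))).
      split; intro p; destruct (nX (inhabits p)). }
  assert (iK : inhabited K).
  { apply NNPP. intro nK. destruct iX as [p]. apply (Hseg p).
    exists (fun k => False_rect _ (nK (inhabits k))).
    split; intro k; destruct (nK (inhabits k)). }
  destruct (wf_rec (Y := K) R (fun p u k => (forall q, R q p -> u q <> k) /\
     forall k', k' < k -> exists q, R q p /\ u q = k')) as [G HG]; auto.
  - intros x u v y E [H1 H2]. split.
    + intros q Hq. rewrite <- E; auto.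
    + intros k' Hk. destruct (H2 k' Hk) as [q [Hq e]]. exists q.
      rewrite <- E; auto.
  - intros p u.
    destruct (least (fun k => forall q, R q p -> u q <> k)) as [k [H1 H2]].
    + apply NNPP. intro N. apply (Hseg p).
      apply (inj_trans _ (fun k => exists q, R q p /\ u q = k)).
      2: now apply inj_image.
      apply inj_sub. intros k _. apply NNPP. intro M. apply N. exists k.
      intros q Hq e. eauto.
    + exists k. split; [exact H1|]. intros k' Hk. apply NNPP. intro N.
      assert (k <= k'); [|ord]. apply H2. intros q Hq e. eauto.
  - exists G. split.
    + intros q p Hqp. destruct (HG p) as [H1 _], (HG q) as [_ H2].
      specialize (H1 q Hqp) as Hne.
      (* If [G p < G q], then [G p] is a value at a predecessor of [q], which is also a predecessor
         of [p]. *)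
      apply NNPP; intro N. assert (L : G p < G q) by ord.
      destruct (H2 _ L) as [r [Hr e]]. exact (H1 r (tr _ _ _ Hr Hqp) e).
    + intro p. apply HG.
Qed.

End Collapse.

(** * Well-orders from lexicographic products and inverse images *)

Definition lex {X Y : Type} (R : X -> X -> Prop) (S : Y -> Y -> Prop)
    (q p : X * Y) : Prop :=
  R (fst q) (fst p) \/ fst q = fst p /\ S (snd q) (snd p).

Lemma lex_wellorder {X Y : Type} (R : X -> X -> Prop) (S : Y -> Y -> Prop) :
  is_wellorder R -> is_wellorder S -> is_wellorder (lex R S).
Proof.
  intros HR HS. unfold lex. split; [|split; [|split]].
  - intros [x y] [H|[_ H]]; cbn in H; exact (lt_irr _ H).
  - intros [x y] [x' y'] [x'' y''] [H|[e H]] [H'|[e' H']]; cbn in *; subst; auto.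
    + left. exact (lt_trans _ _ _ H H').
    + right. split; [reflexivity|]. exact (lt_trans _ _ _ H H').
  - intros [x y] [x' y']. cbn. destruct (lt_tri x x') as [|[->|]]; auto.
    destruct (lt_tri y y') as [|[->|]]; auto.
  - intros [x y]. revert y.
    induction x as [x IHx] using (well_founded_ind (lt_wf (lt := R))). intro y.
    induction y as [y IHy] using (well_founded_ind (lt_wf (lt := S))).
    constructor. intros [x' y'] [H|[e H]]; cbn in *; subst; auto.
Qed.

Lemma inverse_image_wellorder {X Y : Type} (R : Y -> Y -> Prop) (f : X -> Y) :
  (forall x y, f x = f y -> x = y) -> is_wellorder R ->
  is_wellorder (fun x y => R (f x) (f y)).
Proof.
  intros Hf HR. split; [|split; [|split]].
  - intro x. apply lt_irr.
  - intros x y z. apply lt_trans.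
  - intros x y. destruct (lt_tri (f x) (f y)) as [|[|]]; auto.
  - apply wf_inverse_image, lt_wf.
Qed.

(** * Cardinal arithmetic *)

Section Cardinals.
Context {K : Type} {lt : K -> K -> Prop} {mu0 : K} (HK : is_succ_card lt mu0).
#[local] Instance succ_card_wellorder : is_wellorder lt := proj1 HK.
Notation "x < y" := (lt x y) : ord_scope.
Notation "x <= y" := (le lt x y) : ord_scope.
Notation seg a := (fun x => x < a).
Notation cseg a := (fun x => x <= a).
Notation all X := (fun _ : X => True).

Lemma nat_inj_mu : inj (all nat) (seg mu0).
Proof. destruct HK as [_ [[f [f1 f2]] _]]. exists f. auto. Qed.
Lemma seg_inj_mu a : inj (seg a) (seg mu0).
Proof. apply HK. Qed.
Lemma not_inj_mu : ~ inj (all K) (seg mu0).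
Proof. apply HK. Qed.

Definition omax (p : K * K) : K :=
  if excluded_middle_informative (fst p < snd p) then snd p else fst p.

Lemma omax_spec p : fst p <= omax p /\ snd p <= omax p /\
  (omax p = fst p \/ omax p = snd p).
Proof.
  unfold omax. destruct (excluded_middle_informative _) as [h|h].
  - repeat split; auto; unfold le; auto.
  - repeat split; auto; [unfold le; auto|]. now apply not_lt.
Qed.

(** Goedel's canonical order of pairs. Comparing maxima first confines the predecessors of [p] to
    the square of [cseg (omax p)]. *)
Definition goedel_lt (q p : K * K) : Prop :=
  lex lt (lex lt lt) (omax q, q) (omax p, p).

#[local] Instance goedel_wellorder : is_wellorder goedel_lt.
Proof.
  apply (inverse_image_wellorder (lex lt (lex lt lt)) (fun p => (omax p, p))).
  - intros x y e. now injection e.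
  - repeat apply lex_wellorder; exact _.
Qed.

Lemma cseg_square_nat m : inj (seg m) (all nat) ->
  inj (prod_set (cseg m) (cseg m)) (all nat).
Proof.
  intros [f [_ Hf]]. eapply inj_trans; [|apply inj_prod_nat].
  assert (inj (cseg m) (all nat)); [|now apply inj_prod].
  (* To adjoin one point, [m] takes 0 and all other values move up by one. *)
  exists (fun x => if excluded_middle_informative (x = m) then 0 else S (f x)).
  split; [auto|]. intros x y Hx Hy.
  destruct (excluded_middle_informative (x = m)), (excluded_middle_informative (y = m));
    intro E; try discriminate; [congruence|].
  injection E. apply Hf.
  - destruct Hx; [assumption|contradiction].
  - destruct Hy; [assumption|contradiction].
Qed.

Lemma cseg_square m :
  inj (prod_set (seg m) (seg m)) (seg m) \/ inj (prod_set (seg m) (seg m)) (all nat) ->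
  inj (prod_set (cseg m) (cseg m)) (seg m) \/
  inj (prod_set (cseg m) (cseg m)) (all nat).
Proof.
  intros [H|H].
  - destruct (classic (exists u v, u < m /\ v < m /\ u <> v)) as [[u [v [hu [hv n]]]]|N].
    + left. eapply inj_trans; [|exact H].
      assert (inj (cseg m) (seg m)); [|now apply inj_prod].
      eapply inj_trans; [|exact H].
      (* The points below [m] occupy the diagonal, which leaves the pair [(u, v)] free for [m]. *)
      exists (fun x => if excluded_middle_informative (x = m) then (u, v) else (x, x)).
      split.
      * intros x Hx. destruct (excluded_middle_informative (x = m)); split; cbn; auto;
          destruct Hx; auto; contradiction.
      * intros x y _ _.
        destruct (excluded_middle_informative (x = m)), (excluded_middle_informative (y = m));
          intro E; congruence.
    + right. apply cseg_square_nat. exists (fun _ => 0). split; [auto|].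
      intros x y Hx Hy _. apply NNPP. intro. apply N. eauto.
  - right. apply cseg_square_nat. eapply inj_trans; [|exact H].
    exists (fun x => (x, x)). split; [now split|]. intros x y _ _ e. now injection e.
Qed.

(* A least counterexample [a] would be an uncountable initial ordinal; then every
   proper initial segment of the Goedel order on [a * a] has size less than [a],
   so that order collapses into [a]. *)
Lemma square_seg a :
  inj (prod_set (seg a) (seg a)) (seg a) \/ inj (prod_set (seg a) (seg a)) (all nat).
Proof.
  induction a as [a IH] using (well_founded_ind lt_wf).
  apply NNPP. intro N.
  assert (Nnat : ~ inj (seg a) (all nat)).
  { intro H. apply N. right. eapply inj_trans; [|apply inj_prod_nat].
    now apply inj_prod. }
  assert (Nseg : forall m, m < a -> ~ inj (seg a) (seg m)).
  { intros m Hm H. apply N. destruct (IH m Hm) as [I|I].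
    - left. eapply inj_trans; [apply (inj_prod _ _ _ _ H H)|].
      eapply inj_trans; [exact I|]. apply inj_sub. intros x Hx. ord.
    - right. eapply inj_trans; [apply (inj_prod _ _ _ _ H H)|exact I]. }
  set (P := prod_set (seg a) (seg a)).
  pose (R q p := P q /\ P p /\ goedel_lt q p).
  assert (HR : forall p, P p ->
    inj (fun q => R q p) (prod_set (cseg (omax p)) (cseg (omax p))) /\ omax p < a).
  { intros p Hp. split.
    - apply inj_sub. intros q [_ [_ H]]. destruct (omax_spec q) as [o1 [o2 _]].
      assert (omax q <= omax p) by (destruct H as [H|[H _]]; [left|right]; exact H).
      split; ord.
    - destruct (omax_spec p) as [_ [_ [e|e]]]; rewrite e; apply Hp. }
  destruct (collapse (lt := lt) R) as [G [G1 G2]].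
  - apply (wf_incl _ R goedel_lt); [|apply lt_wf]. intros q p [_ [_ H]]. exact H.
  - intros x y z [Hx [_ H]] [_ [Hz H']]. repeat split; try apply Hx; try apply Hz.
    exact (lt_trans _ _ _ H H').
  - intros p H. destruct (classic (P p)) as [Hp|Hp].
    + destruct (HR p Hp) as [I l]. apply not_inj_mu.
      eapply inj_trans; [exact H|]. eapply inj_trans; [exact I|].
      destruct (cseg_square (omax p) (IH _ l)) as [J|J];
        (eapply inj_trans; [exact J|]); [apply seg_inj_mu|apply nat_inj_mu].
    + destruct H as [f [f1 _]]. destruct (f1 mu0 I) as [_ [H _]]. contradiction.
  - apply N. left. exists G. split.
    + intros p Hp. apply NNPP. intro L.
      destruct (HR p Hp) as [I l].
      assert (J : inj (seg a) (prod_set (cseg (omax p)) (cseg (omax p)))).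
      { eapply inj_trans; [|exact I].
        eapply inj_trans; [|apply (inj_image _ G (inhabits p))].
        apply inj_sub. intros x Hx. apply G2. ord. }
      destruct (cseg_square (omax p) (IH _ l)) as [J'|J'].
      * exact (Nseg _ l (inj_trans _ _ _ J J')).
      * exact (Nnat (inj_trans _ _ _ J J')).
    + intros q p Hq Hp e. destruct (lt_tri (lt := goedel_lt) q p) as [H|[H|H]]; auto.
      * assert (G q < G p) by (apply G1; repeat split; auto; apply Hq || apply Hp). ord.
      * assert (G p < G q) by (apply G1; repeat split; auto; apply Hq || apply Hp). ord.
Qed.

(** * Sets of size at most mu, that is, of fewer than mu^+ elements *)

Definition small {X : Type} (P : X -> Prop) : Prop := inj P (seg mu0).

Lemma small_prod {X Y : Type} (P : X -> Prop) (Q : Y -> Prop) :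
  small P -> small Q -> small (prod_set P Q).
Proof.
  intros HP HQ. eapply inj_trans; [apply (inj_prod _ _ _ _ HP HQ)|].
  destruct (square_seg mu0) as [H|H]; [exact H|].
  eapply inj_trans; [exact H|apply nat_inj_mu].
Qed.

Lemma small_sub {X : Type} (P Q : X -> Prop) :
  (forall x, P x -> Q x) -> small Q -> small P.
Proof. intros H. apply inj_trans, inj_sub, H. Qed.

Lemma small_image {X Y : Type} (P : X -> Prop) (f : X -> Y) :
  inhabited X -> small P -> small (fun y => exists x, P x /\ f x = y).
Proof. intros i. apply inj_trans, inj_image, i. Qed.

(** Otherwise [K] would be [cseg a], which embeds diagonally in its own square, and [cseg_square]
    embeds that square in mu. *)
Lemma no_max a : exists b, a < b.
Proof.
  apply NNPP. intro N.
  destruct (cseg_square a (square_seg a)) as [H|H]; apply not_inj_mu.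
  - apply (inj_trans _ (prod_set (cseg a) (cseg a))).
    + exists (fun x => (x, x)). split.
      * intros x _. assert (x <= a); [|now split]. apply not_lt. eauto.
      * intros x y _ _ e. now injection e.
    + eapply inj_trans; [exact H|apply seg_inj_mu].
  - apply (inj_trans _ (prod_set (cseg a) (cseg a))).
    + exists (fun x => (x, x)). split.
      * intros x _. assert (x <= a); [|now split]. apply not_lt. eauto.
      * intros x y _ _ e. now injection e.
    + eapply inj_trans; [exact H|apply nat_inj_mu].
Qed.

Lemma succ_exists : exists S : K -> K, forall a b, a < b <-> S a <= b.
Proof.
  apply (choice (fun a s => forall b, a < b <-> s <= b)). intro a.
  destruct (least (fun b => a < b) (no_max a)) as [s [H1 H2]].
  exists s. intro b. split; [apply H2|]. ord.
Qed.

(* [K] would be the union of few proper initial segments. *)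
Lemma small_bounded (P : K -> Prop) : small P -> exists b, forall x, P x -> x < b.
Proof.
  intro HP. apply NNPP. intro N. apply not_inj_mu.
  destruct (choice (fun b x => P x /\ b <= x)) as [up Hup].
  { intro b. apply NNPP. intro M. apply N. exists b. intros x Hx.
    apply NNPP. intro L. apply M. exists x. split; [exact Hx|]. ord. }
  destruct (choice (fun a f => (forall x, x <= a -> f x < mu0) /\
     (forall x y, x <= a -> y <= a -> f x = f y -> x = y))) as [f Hf].
  { intro a. destruct (no_max a) as [b Hb].
    destruct (seg_inj_mu b) as [f [f1 f2]]. exists f.
    split; [intros x Hx; apply f1; ord|].
    intros x y Hx Hy. apply f2; ord. }
  eapply inj_trans; [|apply (small_prod _ _ HP (seg_inj_mu mu0))].
  exists (fun x => (up x, f (up x) x)). split.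
  - intros x _. split; cbn; [apply Hup|]. apply Hf. apply Hup.
  - intros x y _ _ e. injection e as e1 e2. rewrite e1 in e2.
    apply (Hf (up y)); [rewrite <- e1; apply Hup|apply Hup|exact e2].
Qed.

Lemma small_cseg a : small (cseg a).
Proof.
  destruct (no_max a) as [b Hb]. apply (small_sub _ (seg b)); [|apply seg_inj_mu].
  ord.
Qed.

Lemma two_below_mu : exists u v, u < mu0 /\ v < mu0 /\ u <> v.
Proof.
  destruct nat_inj_mu as [f [f1 f2]]. exists (f 0), (f 1). repeat split; auto.
  intro E. discriminate (f2 0 1 I I E).
Qed.

Lemma small_union {X : Type} (P Q : X -> Prop) :
  small P -> small Q -> small (fun x => P x \/ Q x).
Proof.
  intros [f [f1 f2]] [g [g1 g2]]. destruct two_below_mu as [u [v [Hu [Hv n]]]].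
  eapply inj_trans; [|apply (small_prod _ _ (seg_inj_mu mu0) (seg_inj_mu mu0))].
  exists (fun x => if excluded_middle_informative (P x) then (u, f x) else (v, g x)).
  split.
  - intros x Hx. destruct (excluded_middle_informative (P x)); split; cbn; auto.
    apply g1. tauto.
  - intros x y Hx Hy.
    destruct (excluded_middle_informative (P x)), (excluded_middle_informative (P y));
      intro E; injection E; intros; try congruence; [apply f2|apply g2]; tauto.
Qed.

(** Prepares codes of finite sequences: [z] stands for the empty one and [pr] prepends an entry. The
    tags [u] and [v] keep [z] out of the range of [pr]. *)
Lemma tagged_pairing (P : K -> Prop) :
  inj (prod_set P P) P -> (exists u v, P u /\ P v /\ u <> v) ->
  exists (z : K) (pr : K -> K -> K), P z /\
    (forall x y, P x -> P y -> P (pr x y) /\ pr x y <> z) /\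
    (forall x y x' y', P x -> P y -> P x' -> P y' -> pr x y = pr x' y' ->
       x = x' /\ y = y').
Proof.
  intros [f [f1 f2]] [u [v [Hu [Hv n]]]].
  exists (f (u, u)), (fun x y => f (v, f (x, y))).
  assert (Hf : forall x y, P x -> P y -> P (f (x, y))).
  { intros x y Hx Hy. apply f1. now split. }
  assert (Hi : forall x y x' y', P x -> P y -> P x' -> P y' ->
    f (x, y) = f (x', y') -> x = x' /\ y = y').
  { intros x y x' y' Hx Hy Hx' Hy' E.
    assert (E' : (x, y) = (x', y')) by (apply f2; try split; assumption).
    now injection E'. }
  split; [now apply Hf|]. split.
  - intros x y Hx Hy. split; [auto|]. intro E. apply Hi in E; auto.
    destruct E. congruence.
  - intros x y x' y' Hx Hy Hx' Hy' E. apply Hi in E; auto. destruct E as [_ E].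
    now apply Hi in E.
Qed.

Lemma mu_pairing : exists (z : K) (pr : K -> K -> K), z < mu0 /\
    (forall x y, x < mu0 -> y < mu0 -> pr x y < mu0 /\ pr x y <> z) /\
    (forall x y x' y', x < mu0 -> y < mu0 -> x' < mu0 -> y' < mu0 ->
       pr x y = pr x' y' -> x = x' /\ y = y').
Proof.
  apply (tagged_pairing (seg mu0)); [|apply two_below_mu].
  apply small_prod; apply seg_inj_mu.
Qed.

(* [mu0 * K] is isomorphic to [K]: [G a x] is the ordinal mu * a + x. *)
Lemma blocks : exists (G : K -> K -> K) (pi rho : K -> K),
  (forall k, G (pi k) (rho k) = k) /\ (forall k, rho k < mu0) /\
  (forall a x, x < mu0 -> pi (G a x) = a /\ rho (G a x) = x) /\
  (forall k l, k < l <-> pi k < pi l \/ pi k = pi l /\ rho k < rho l).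
Proof.
  pose (P := fun p : K * K => snd p < mu0).
  pose (R q p := P q /\ P p /\ lex lt lt q p).
  pose proof (lex_wellorder lt lt _ _) as WL.
  destruct (collapse (lt := lt) R) as [G [G1 G2]].
  - apply (wf_incl _ R (lex lt lt)); [|apply WL]. intros q p [_ [_ H]]. exact H.
  - intros x y z [Hx [_ H]] [_ [Hz H']]. repeat split; auto.
    exact (lt_trans _ _ _ H H').
  - intros p H. apply not_inj_mu. eapply inj_trans; [exact H|].
    apply (small_sub _ (prod_set (cseg (fst p)) (seg mu0))).
    + intros q [Hq [_ L]]. split; [|exact Hq]. destruct L as [L|[L _]]; [left|right]; auto.
    + apply small_prod; [apply small_cseg|apply seg_inj_mu].
  - assert (Gi : forall q p, P q -> P p -> G q = G p -> q = p).
    { intros q p Hq Hp e. destruct (lt_tri (lt := lex lt lt) q p) as [H|[H|H]]; auto.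
      - assert (G q < G p) by (apply G1; repeat split; auto). ord.
      - assert (G p < G q) by (apply G1; repeat split; auto). ord. }
    assert (Gs : forall k, exists p, P p /\ G p = k).
    { intro k. apply NNPP. intro N. destruct two_below_mu as [u [_ [Hu _]]].
      apply not_inj_mu. apply (inj_trans _ (seg k)); [|apply seg_inj_mu].
      (* The values of [G] on [P] form an initial segment, so if [k] is missed they all lie below
         [k]. *)
      exists (fun a => G (a, u)). split.
      - intros a _. apply NNPP. intro M.
        assert (L : k <= G (a, u)) by ord.
        destruct L as [L|L]; [|apply N; exists (a, u); auto].
        destruct (G2 _ _ L) as [q [[Hq _] E]]. eauto.
      - intros a b _ _ E. apply Gi in E; [now injection E|exact Hu|exact Hu]. }
    destruct (choice _ Gs) as [F HF].
    exists (fun a x => G (a, x)), (fun k => fst (F k)), (fun k => snd (F k)).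
    assert (HFG : forall a x, x < mu0 -> F (G (a, x)) = (a, x)).
    { intros a x Hx. apply Gi; [apply HF|exact Hx|]. apply HF. }
    split; [|split; [|split]].
    + intro k. rewrite <- surjective_pairing. apply HF.
    + intro k. apply HF.
    + intros a x Hx. now rewrite HFG.
    + intros k l. destruct (HF k) as [Pk Ek], (HF l) as [Pl El]. split.
      * intro L. destruct (lt_tri (lt := lex lt lt) (F k) (F l)) as [H|[H|H]].
        -- exact H.
        -- rewrite <- Ek, <- El, H in L. now apply lt_irr in L.
        -- assert (G (F l) < G (F k)) by (apply G1; repeat split; auto).
           rewrite Ek, El in *. ord.
      * intro L. rewrite <- Ek, <- El. apply G1. repeat split; auto.
Qed.

Lemma K_pairing : exists (z : K) (pr : K -> K -> K),
    (forall x y, pr x y <> z) /\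
    (forall x y x' y', pr x y = pr x' y' -> x = x' /\ y = y').
Proof.
  destruct (tagged_pairing (all K)) as [z [pr [_ [H1 H2]]]].
  - destruct blocks as [G [pi [rho [_ [_ [HG _]]]]]].
    destruct (choice (fun m f => forall p, prod_set (cseg m) (cseg m) p ->
      f p < mu0 /\ forall q, prod_set (cseg m) (cseg m) q -> f p = f q -> p = q))
      as [c Hc].
    { intro m. destruct (small_prod _ _ (small_cseg m) (small_cseg m)) as [f [f1 f2]].
      exists f. auto. }
    assert (O : forall p, prod_set (cseg (omax p)) (cseg (omax p)) p).
    { intro p. split; apply omax_spec. }
    (* The maximum of the pair selects the block, and inside the block the pair is numbered within
       the square of [cseg (omax p)], which is small. *)
    exists (fun p => G (omax p) (c (omax p) p)). split; [auto|].
    intros p q _ _ E.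
    destruct (HG (omax p) (c (omax p) p)) as [p1 p2]; [apply Hc, O|].
    destruct (HG (omax q) (c (omax q) q)) as [q1 q2]; [apply Hc, O|].
    rewrite E in p1, p2. rewrite p1 in q1. rewrite p2 in q2.
    apply (Hc (omax p)); [apply O|rewrite q1; apply O|rewrite q2, q1; reflexivity].
  - destruct two_below_mu as [u [v [_ [_ n]]]]. now exists u, v.
  - exists z, pr. split; [intros; apply H1; auto|]. auto.
Qed.

(** [d] is the supremum of omega iterates, from [a] on, of a function that jumps above [x] and above
    [F y] for all [y <= x]. It exists because countable sets are bounded. *)
Lemma closure_point (F : K -> K) a : exists d, a < d /\ forall x, x < d -> F x < d.
Proof.
  destruct (choice (fun x b => x < b /\ forall y, y <= x -> F y < b)) as [F' HF].
  { intro x.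
    destruct (small_bounded _ (small_union _ _ (small_cseg x)
       (small_image (cseg x) F (inhabits a) (small_cseg x)))) as [b Hb].
    exists b. split; [apply Hb; left; now right|]. intros y Hy. apply Hb. eauto. }
  pose (it n := nat_rect (fun _ => K) a (fun _ => F') n).
  assert (B : exists b, forall n, it n < b).
  { destruct (small_bounded (fun y => exists n, True /\ it n = y)) as [b Hb].
    - apply small_image; [exact (inhabits 0)|apply nat_inj_mu].
    - exists b. intro n. apply Hb. eauto. }
  destruct (least _ B) as [d [H1 H2]]. exists d. split; [apply (H1 0)|].
  intros x Hx. assert (N : exists n, x <= it n).
  { apply NNPP. intro N. assert (d <= x); [|ord]. apply H2. intro n.
    apply NNPP. intro. apply N. exists n. ord. }
  destruct N as [n Hn]. apply (lt_trans _ (it (S n))); [|apply H1].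
  now apply (HF (it n)).
Qed.

Lemma small_weakly_coherent (C : K -> K -> Prop) :
  (forall e, small (fun A => exists d, A = fun y => C d y /\ y < e)) ->
  weakly_coherent lt C.
Proof.
  intros H e. destruct (H e) as [f [f1 f2]].
  (* The set with index [x] is the union of the traces coded by [x]; injectivity of [f] leaves at
     most one such trace. *)
  exists mu0, (fun x y => exists d, f (fun y => C d y /\ y < e) = x /\ C d y /\ y < e).
  intro d. exists (f (fun y => C d y /\ y < e)). split; [apply f1; eauto|].
  intro y. split; [eauto|]. intros [d' [E Hy]]. apply f2 in E; eauto.
  change ((fun y => C d y /\ y < e) y). now rewrite <- E.
Qed.

(** * Specializing functions *)

Section SpecialTree.
Context {T : Type} {tlt : T -> T -> Prop} {h : T -> K}.
Context (HT : is_kappa_tree lt tlt h).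

Lemma tlt_wf : well_founded tlt.
Proof.
  apply (wf_incl _ _ (fun x y => h x < h y)); [intros x y; apply HT|].
  apply wf_inverse_image, lt_wf.
Qed.

(* Iterate the regressive function down to a minimal node, recording the colours
   met on the way: this finite sequence determines a node among comparable ones. *)
Lemma special_coloring : special lt tlt ->
  exists g : T -> K, (forall x, g x < mu0) /\ forall x y, tlt x y -> g x <> g y.
Proof.
  intros [f [Hf Hc]]. destruct (choice _ Hc) as [b Hb]. destruct (choice _ Hb) as [c Hcol].
  destruct (choice _ seg_inj_mu) as [i Hi]. destruct mu_pairing as [z [pr [z1 [pr1 pr2]]]].
  destruct (wf_rec tlt (fun x u k =>
    ~ (exists y, tlt y x) /\ k = z \/
    (exists y, tlt y x) /\ k = pr (i (b (f x)) (c (f x) x)) (u (f x)))) as [g Hg].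
  - exact tlt_wf.
  - exact (inhabits mu0).
  - intros x u v k E [H|[H ->]]; [left; exact H|right]. rewrite E; auto.
  - intros x u. destruct (classic (exists y, tlt y x)); eauto.
  - assert (Ci : forall x, i (b (f x)) (c (f x) x) < mu0).
    { intro x. apply Hi. apply (Hcol (f x) x eq_refl). }
    assert (Hmu : forall x, g x < mu0).
    { intro x. induction x as [x IH] using (well_founded_ind tlt_wf).
      destruct (Hg x) as [[_ ->]|[H ->]]; [exact z1|]. apply pr1; auto. }
    exists g. split; [exact Hmu|].
    assert (Inj : forall x y, x = y \/ tlt x y \/ tlt y x -> g x = g y -> x = y).
    { intro x. induction x as [x IH] using (well_founded_ind tlt_wf).
      intros y Hxy E. destruct (Hg x) as [[N Ex]|[Px Ex]], (Hg y) as [[M Ey]|[Py Ey]].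
      - destruct Hxy as [|[|]]; [assumption| |]; exfalso; eauto.
      - exfalso. rewrite Ex, Ey in E. symmetry in E. revert E. apply pr1; auto.
      - exfalso. rewrite Ex, Ey in E. revert E. apply pr1; auto.
      - rewrite Ex, Ey in E. apply pr2 in E; auto. destruct E as [E1 E2].
        assert (Efx : f x = f y).
        (* [f x] and [f y] both lie below the larger of [x] and [y], so they are comparable. Once
           they are equal, [x] and [y] share a fibre and a colour, and hence an antichain. *)
        { apply IH; auto. destruct HT as [_ [Tt [Tc _]]].
          destruct Hxy as [->|[L|L]]; [now left|apply (Tc y)|apply (Tc x)]; eauto. }
        rewrite <- Efx in E1. destruct (Hcol (f x) x eq_refl) as [bx Hx].
        destruct (Hcol (f x) y (eq_sym Efx)) as [by_ _].
        apply Hi in E1; auto. apply NNPP. intro n.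
        destruct (Hx y (eq_sym Efx) E1 n). destruct Hxy as [|[|]]; auto. }
    intros x y L E. assert (x = y) by auto. subst y. revert L. apply HT.
Qed.

(** The colouring is injective on chains, so a chain of size mu^+ would inject into mu. *)
Lemma special_aronszajn : special lt tlt -> aronszajn (K := K) tlt.
Proof.
  intros Hs B HB [e [e1 e2]]. destruct (special_coloring Hs) as [g [g1 g2]].
  apply not_inj_mu. exists (fun a => g (e a)). split; [auto|].
  intros a b _ _ E. apply e2. destruct (HB (e a) (e b)) as [|[L|L]]; auto.
  - now apply g2 in L.
  - symmetry in E. now apply g2 in L.
Qed.

End SpecialTree.

(** * A special tree from a sequence with small initial order types *)

Section Walks.
Context {C : K -> K -> Prop} (HC : is_Cseq lt C).

(** [c] is the minimum of C_b \ x, the first step of the minimal walk from [b] to [x]. *)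
Definition next_spec (b x c : K) : Prop :=
  C b c /\ x <= c /\ c < b /\ forall c', C b c' -> x <= c' -> c <= c'.

Lemma next_exists : exists next : K -> K -> K,
  forall b x, x < b -> next_spec b x (next b x).
Proof.
  apply (choice (fun b f => forall x, x < b -> next_spec b x (f x))). intro b.
  apply choice_on; [exact (inhabits b)|]. intros x Hx.
  destruct (HC b) as [C1 [_ C3]].
  destruct (C3 x Hx) as [c0 Hc0].
  destruct (least (fun c => C b c /\ x <= c)) as [c [[H1 H2] H3]]; [now exists c0|].
  exists c. repeat split; auto.
Qed.

Definition is_otp (A : K -> Prop) (o : K) : Prop :=
  otp_le lt A o /\ forall o', otp_le lt A o' -> o <= o'.

Lemma otp_exists : exists ot : K -> K -> K,
  forall b x, is_otp (fun y => C b y /\ y < x) (ot b x).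
Proof.
  apply (choice (fun b f => forall x, is_otp (fun y => C b y /\ y < x) (f x))).
  intro b. apply (choice (fun x => is_otp (fun y => C b y /\ y < x))). intro x.
  apply least. exists x, (fun y => y). split; auto.
  now intros y [_ H].
Qed.

Lemma is_otp_ext (A B : K -> Prop) o o' :
  (forall y, A y <-> B y) -> is_otp A o -> is_otp B o' -> o = o'.
Proof.
  intros H [[f [f1 f2]] H1] [[g [g1 g2]] H2].
  assert (o <= o'). { apply H1. exists g. split; intros; [apply g1|apply g2]; firstorder. }
  assert (o' <= o). { apply H2. exists f. split; intros; [apply f1|apply f2]; firstorder. }
  ord.
Qed.

(** If some [c] in C_b had x <= c < x', an embedding of C_b below x' into [o] would carry C_b below
    x into [f c < o], against the minimality of [o]. *)
Lemma is_otp_gap b x x' o :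
  is_otp (fun y => C b y /\ y < x) o -> is_otp (fun y => C b y /\ y < x') o ->
  forall c, C b c -> x <= c -> x' <= c.
Proof.
  intros [_ H1] [[f [f1 f2]] _] c Hc Hxc. apply NNPP. intro L. apply not_le in L.
  assert (o <= f c).
  { apply H1. exists f. split.
    - intros y [Hy Ly]. apply f2; repeat split; auto; ord.
    - intros y y' [Hy Ly] [Hy' Ly']. apply f2; split; auto; ord. }
  assert (f c < o) by (apply f1; auto). ord.
Qed.

Context {next ot pr : K -> K -> K} {z : K}.
Context (Hnext : forall b x, x < b -> next_spec b x (next b x)).
Context (Hot : forall b x, is_otp (fun y => C b y /\ y < x) (ot b x)).
Context (prz : forall x y, pr x y <> z).
Context (pri : forall x y x' y', pr x y = pr x' y' -> x = x' /\ y = y').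

(* [phi b x] codes the order types met along the walk from [b] down to [x]. *)
Definition is_walk_code (phi : K -> K -> K) : Prop := forall b x,
  (x < b -> phi b x = pr (ot b x) (phi (next b x) x)) /\ (~ x < b -> phi b x = z).

Lemma walk_code_exists : exists phi, is_walk_code phi.
Proof.
  apply (wf_rec lt (fun b u v => forall x,
    (x < b -> v x = pr (ot b x) (u (next b x) x)) /\ (~ x < b -> v x = z))).
  - exact lt_wf.
  - exact (inhabits (fun x => x)).
  - intros b u v w E H x. split; [|apply H]. intro L.
    rewrite <- E; [now apply H|]. now apply Hnext.
  - intros b u. apply (choice (fun x y =>
      (x < b -> y = pr (ot b x) (u (next b x) x)) /\ (~ x < b -> y = z))).
    intro x. destruct (classic (x < b)) as [H|H].
    + eexists. split; [reflexivity|contradiction].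
    + eexists. split; [contradiction|reflexivity].
Qed.

Context {phi : K -> K -> K} (Hphi : is_walk_code phi).

(** Equal codes begin with equal order types, so by [is_otp_gap] both walks take the same first step
    and induction applies. A walk that has already arrived has code [z], which is no value of
    [pr]. *)
Lemma walk_code_inj b x x' : x < x' -> x' <= b -> phi b x <> phi b x'.
Proof.
  revert x x'. induction b as [b IH] using (well_founded_ind lt_wf).
  intros x x' L L' E.
  assert (Lx : x < b) by ord. rewrite (proj1 (Hphi b x) Lx) in E.
  destruct L' as [L'|<-].
  2:{ rewrite (proj2 (Hphi x' x') (lt_irr x')) in E. now apply prz in E. }
  rewrite (proj1 (Hphi b x') L') in E. apply pri in E. destruct E as [E1 E2].
  pose proof (Hot b x') as O. rewrite <- E1 in O.
  pose proof (is_otp_gap _ _ _ _ (Hot b x) O) as Gap.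
  destruct (Hnext b x Lx) as [n1 [n2 [n3 n4]]], (Hnext b x' L') as [m1 [m2 [m3 m4]]].
  assert (En : next b x = next b x').
  { assert (next b x <= next b x') by (apply n4; auto; ord).
    assert (next b x' <= next b x) by (apply m4; auto). ord. }
  rewrite En in *. exact (IH _ m3 x x' L m2 E2).
Qed.

(** The walk stays at or above [d], so each recorded order type is below [d] by the definition of
    [Rset], and closure under [pr] keeps the code there. *)
Lemma walk_code_regressive d :
  Rset lt C d -> z < d -> (forall x y, x < d -> y < d -> pr x y < d) ->
  forall b, d <= b -> phi b d < d.
Proof.
  intros [_ HR] Hz Hpr b. induction b as [b IH] using (well_founded_ind lt_wf).
  intros [L|<-].
  - rewrite (proj1 (Hphi b d) L). apply Hpr.
    + destruct (HR b L) as [o [Ho O]]. destruct (Hot b d) as [_ H].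
      specialize (H o O). ord.
    + destruct (Hnext b d L) as [_ [H1 [H2 _]]]. auto.
  - now rewrite (proj2 (Hphi d d) (lt_irr d)).
Qed.

(** * The tree of restrictions of walk codes *)

Definition agree (a b c : K) : Prop := forall x, x <= a -> phi b x = phi c x.

(** A step landing below [a] lands in both sets, so the two steps coincide. Otherwise both are
    already the least elements at or above [a]. *)
Lemma next_agree a b c x : (forall y, y < a -> (C b y <-> C c y)) ->
  a < b -> a < c -> x <= a ->
  next b x = next c x \/ next b x = next b a /\ next c x = next c a.
Proof.
  intros H Hb Hc Hx.
  assert (Lb : x < b) by ord. assert (Lc : x < c) by ord.
  destruct (Hnext b x Lb) as [b1 [b2 [_ b4]]], (Hnext c x Lc) as [c1 [c2 [_ c4]]].
  destruct (Hnext b a Hb) as [b1' [b2' [_ b4']]], (Hnext c a Hc) as [c1' [c2' [_ c4']]].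
  destruct (classic (next b x < a)) as [L|L]; [|destruct (classic (next c x < a)) as [M|M]].
  - left. assert (next c x <= next b x) by (apply c4; [now apply H|assumption]).
    assert (next b x <= next c x); [|ord]. apply b4; [apply H; [ord|assumption]|assumption].
  - left. assert (next b x <= next c x) by (apply b4; [now apply H|assumption]).
    assert (next c x <= next b x); [|ord]. apply c4; [apply H; [ord|assumption]|assumption].
  - right. split.
    + assert (next b a <= next b x) by (apply b4'; [assumption|ord]).
      assert (next b x <= next b a) by (apply b4; [assumption|ord]). ord.
    + assert (next c a <= next c x) by (apply c4'; [assumption|ord]).
      assert (next c x <= next c a) by (apply c4; [assumption|ord]). ord.
Qed.

(** The traces on [a] of the sets C_(b_i) along the walk from [b] to [a] determine [phi b] on
    [0, a]. Coherence leaves at most mu traces, so [cd b] can code their finite sequence below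
    [mu0]. *)
Lemma level_code a : weakly_coherent lt C -> exists cd : K -> K,
  forall b, a <= b -> cd b < mu0 /\
    forall c, a <= c -> cd b = cd c -> agree a b c.
Proof.
  intro HW. destruct (HW a) as [w [en Hen]]. destruct (choice _ Hen) as [xi Hxi].
  destruct (seg_inj_mu w) as [i [i1 i2]].
  destruct mu_pairing as [z' [pr' [z1 [pr1 pr2]]]].
  assert (Hi : forall b, i (xi b) < mu0). { intro b. apply i1, Hxi. }
  assert (Hco : forall b c, i (xi b) = i (xi c) -> forall y, y < a -> (C b y <-> C c y)).
  { intros b c E y Hy. apply i2 in E; [|apply Hxi|apply Hxi].
    destruct (Hxi b) as [_ Hb], (Hxi c) as [_ Hc]. rewrite E in Hb.
    specialize (Hb y). specialize (Hc y). tauto. }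
  destruct (wf_rec lt (fun b u k => (a < b -> k = pr' (i (xi b)) (u (next b a))) /\
    (~ a < b -> k = z'))) as [cd Hcd].
  - exact lt_wf.
  - exact (inhabits a).
  - intros b u v k E [H1 H2]. split; [|exact H2]. intro L.
    rewrite <- E; [auto|]. now apply Hnext.
  - intros b u. destruct (classic (a < b)) as [H|H].
    + eexists. split; [reflexivity|contradiction].
    + eexists. split; [contradiction|reflexivity].
  - assert (Hmu : forall b, cd b < mu0).
    { intro b. induction b as [b IH] using (well_founded_ind lt_wf).
      destruct (Hcd b) as [H1 H2]. destruct (classic (a < b)) as [L|L].
      - rewrite (H1 L). apply pr1; [apply Hi|]. apply IH. now apply Hnext.
      - now rewrite (H2 L). }
    exists cd. intros b Hb. split; [auto|]. revert Hb.
    induction b as [b IH] using (well_founded_ind lt_wf).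
    intros Hb c Hc E. destruct (Hcd b) as [Bl Bg], (Hcd c) as [Cl Cg].
    destruct Hb as [Hb|<-], Hc as [Hc|<-].
    + rewrite (Bl Hb), (Cl Hc) in E. apply pr2 in E; auto. destruct E as [E1 E2].
      pose proof (Hco _ _ E1) as Co.
      destruct (Hnext b a Hb) as [_ [b2 [b3 _]]], (Hnext c a Hc) as [_ [c2 _]].
      pose proof (IH _ b3 b2 _ c2 E2) as Ag. intros x Hx.
      rewrite (proj1 (Hphi b x)), (proj1 (Hphi c x)) by ord. f_equal.
      * apply (is_otp_ext _ _ _ _) with (2 := Hot b x) (3 := Hot c x). intro y.
        split; intros [H1 H2]; split; auto; apply Co; auto; ord.
      * destruct (next_agree a b c x Co Hb Hc Hx) as [<-|[En En']].
        -- destruct (next_agree a b c x Co Hb Hc Hx); auto.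
        -- rewrite En, En'. now apply Ag.
    + rewrite (Bl Hb), (Cg (lt_irr a)) in E. exfalso. revert E. now apply pr1.
    + rewrite (Bg (lt_irr a)), (Cl Hc) in E. exfalso. symmetry in E. revert E.
      now apply pr1.
    + now intros x Hx.
Qed.

(* A node is a function [phi b] restricted to the ordinals at most [a], represented by
   the pair [(a, b)] with [b >= a] least possible. *)
Definition canonical (p : K * K) : Prop :=
  fst p <= snd p /\ forall c, fst p <= c -> agree (fst p) (snd p) c -> snd p <= c.

Definition node : Type := {p : K * K | canonical p}.
Definition height (t : node) : K := fst (proj1_sig t).
Definition top (t : node) : K := snd (proj1_sig t).
Definition node_lt (s t : node) : Prop :=
  height s < height t /\ agree (height s) (top s) (top t).

Lemma height_top t : height t <= top t.
Proof. apply (proj2_sig t). Qed.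

Lemma node_eq s t : height s = height t -> agree (height s) (top s) (top t) -> s = t.
Proof.
  intros E A. destruct s as [[a b] s], t as [[a' b'] t].
  unfold height, top in *. cbn in *. subst a'.
  assert (b = b').
  { destruct s as [s1 s2], t as [t1 t2]. cbn in *.
    assert (b <= b') by auto. assert (b' <= b); [|ord].
    apply t2; auto. intros x Hx. symmetry. auto. }
  subst b'. f_equal. apply proof_irrelevance.
Qed.

Lemma node_exists a b : a <= b -> exists t, height t = a /\ agree a (top t) b.
Proof.
  intro L. destruct (least (fun c => a <= c /\ agree a c b)) as [c [[H1 H2] H3]].
  { exists b. split; [exact L|]. now intros x Hx. }
  assert (Hc : canonical (a, c)).
  { split; [exact H1|]. cbn. intros d Hd A. apply H3. split; [exact Hd|].
    intros x Hx. rewrite <- H2, A; auto. }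
  exists (exist _ (a, c) Hc). split; [reflexivity|exact H2].
Qed.

Lemma node_restrict t a : a < height t -> exists s, node_lt s t /\ height s = a.
Proof.
  intro L. destruct (node_exists a (top t)) as [s [<- A]].
  - pose proof (height_top t). ord.
  - exists s. repeat split; auto.
Qed.

Lemma node_tree : weakly_coherent lt C -> is_kappa_tree lt node_lt height.
Proof.
  intro HW. split; [|split; [|split; [|split; [|split; [|split]]]]].
  - intros x [H _]. now apply lt_irr in H.
  - intros x y w [H A] [H' A']. split; [ord|]. intros k Hk. rewrite A; auto.
    apply A'. ord.
  - intros t x y [H A] [H' A'].
    destruct (lt_tri (height x) (height y)) as [L|[E|L]].
    + right. left. split; [exact L|]. intros k Hk. rewrite A, A'; auto. ord.
    + left. apply node_eq; [exact E|]. intros k Hk. rewrite A, A'; auto. ord.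
    + right. right. split; [exact L|]. intros k Hk. rewrite A, A'; auto. ord.
  - intros s t H. apply H.
  - intros t a. apply node_restrict.
  - intro a. destruct (node_exists a a) as [t [Ht _]]; [now right|]. eauto.
  - intro a. destruct (level_code a HW) as [cd Hcd]. exists mu0, (fun t => cd (top t)).
    split.
    + intros t <-. apply Hcd. apply height_top.
    + intros s t Hs Ht E. apply node_eq; [congruence|]. rewrite Hs.
      apply (Hcd (top s)); [rewrite <- Hs| rewrite <- Ht |]; auto using height_top.
Qed.

(* Levels in the club [E] regress to level [phi b d < d], which determines [d] along a
   branch; every other level regresses to a level above the last element of [E]. *)
Lemma node_special : contains_club lt (Rset lt C) -> special lt node_lt.
Proof.
  intros [D [[D1 D2] DR]]. destruct succ_exists as [S HS].
  (* Nonzero points closed under [F] exceed [z], are limits of [D] and are closed under [pr], as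
     [walk_code_regressive] requires. *)
  destruct (choice (fun x b => z < b /\ (exists d, D d /\ x < d /\ d < b) /\
    forall y y', y <= x -> y' <= x -> pr y y' < b)) as [F HF].
  { intro x. destruct (no_max x) as [x' Hx']. destruct (D1 x') as [d [Dd Ld]].
    destruct (small_bounded _ (small_image _ (fun p => pr (fst p) (snd p))
      (inhabits (x, x)) (small_prod _ _ (small_cseg x) (small_cseg x)))) as [b1 Hb1].
    destruct (small_bounded _ (small_union _ _ (small_cseg z)
      (small_union _ _ (small_cseg d) (small_cseg b1)))) as [b Hb].
    exists b. split; [apply Hb; left; now right|]. split.
    - exists d. split; [exact Dd|]. split; [ord|]. apply Hb. right. left. now right.
    - intros y y' Hy Hy'. apply (lt_trans _ b1).
      + apply Hb1. exists (y, y'). repeat split; auto.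
      + apply Hb. right. right. now right. }
  pose (E := fun d => (exists x, x < d) /\ forall x, x < d -> F x < d).
  assert (E_club : forall a, exists e, E e /\ a < e).
  { intro a. destruct (closure_point F a) as [e [He1 He2]]. exists e.
    repeat split; eauto. }
  assert (E_reg : forall t, E (height t) -> phi (top t) (height t) < height t).
  { intros t [[x0 Hx0] Ht]. apply walk_code_regressive; [| | |apply height_top].
    - apply DR, D2. split; [eauto|]. intros c Hc.
      destruct (HF c) as [_ [[d [Hd [L1 L2]]] _]]. exists d. specialize (Ht c Hc).
      repeat split; auto. ord.
    - destruct (HF x0) as [H _]. specialize (Ht x0 Hx0). ord.
    - intros x y Hx Hy. destruct (lt_tri x y) as [L|L].
      + destruct (HF y) as [_ [_ H]]. specialize (Ht y Hy).
        specialize (H x y (or_introl L) (or_intror eq_refl)). ord.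
      + destruct (HF x) as [_ [_ H]]. specialize (Ht x Hx).
        assert (L' : y <= x) by (destruct L; ord).
        specialize (H x y (or_intror eq_refl) L'). ord. }
  assert (E_gap : forall a, (exists x, x < a) -> ~ E a ->
    exists e, e < a /\ forall e', E e' -> e < e' -> a <= e').
  (* If [x < a <= F x], then every point of [E] above [x] is above [F x], so [x] serves as [e]. *)
  { intros a Ha Na. apply NNPP. intro N. apply Na. split; [exact Ha|]. intros x Hx.
    apply NNPP. intro M. apply N. exists x. split; [exact Hx|].
    intros e' [_ He'] L. specialize (He' x L). ord. }
  destruct (choice (fun t s => (exists x, x < height t) /\ node_lt s t /\
      (E (height t) /\ height s = phi (top t) (height t) \/
       ~ E (height t) /\ forall e', E e' -> height s < e' -> height t <= e') \/
    ~ (exists x, x < height t) /\ s = t)) as [f Hf].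
  { intro t. destruct (classic (exists x, x < height t)) as [H|H].
    - destruct (classic (E (height t))) as [He|He].
      + destruct (node_restrict t _ (E_reg t He)) as [s [H1 H2]]. exists s. tauto.
      + destruct (E_gap _ H He) as [e [H1 H2]].
        destruct (node_restrict t e H1) as [s [H3 <-]]. exists s. tauto.
    - exists t. tauto. }
  exists f. split.
  { intros x [y [Hy _]]. destruct (Hf x) as [[_ [H _]]|[H _]]; [exact H|].
    exfalso. eauto. }
  intro w.
  destruct (least (fun _ : K => True)) as [c0 [_ Hc0]]; [now exists z|].
  assert (HSlt : forall x, x < S x) by (intro x; apply HS; now right).
  assert (HSi : forall x y, S x = S y -> x = y).
  { intros x y e. destruct (lt_tri x y) as [L|[L|L]]; [|exact L|];
      apply HS in L; [specialize (HSlt y)|specialize (HSlt x)]; ord. }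
  (* Nodes of the fibre with height outside [E] have height at most [n], so their colours are at
     most [S n]. The least element [c0], not a successor, colours the heights in [E]. *)
  destruct (E_club (height w)) as [n [En Ln]]. exists (S (S n)).
  exists (fun t => if excluded_middle_informative (E (height t)) then c0 else S (height t)).
  assert (Main : forall x y, f x = w -> f y = w ->
    (if excluded_middle_informative (E (height x)) then c0 else S (height x)) =
    (if excluded_middle_informative (E (height y)) then c0 else S (height y)) ->
    ~ node_lt x y).
  { intros x y Fx Fy Ec L.
    destruct (excluded_middle_informative (E (height x))) as [Ex|Ex],
      (excluded_middle_informative (E (height y))) as [Ey|Ey].
    - assert (Hx : height w = phi (top x) (height x)).
      { destruct (Hf x) as [[_ [_ [[_ H]|[H _]]]]|[H _]]; [congruence|contradiction|].
        destruct Ex. contradiction. }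
      assert (Hy : height w = phi (top y) (height y)).
      { destruct (Hf y) as [[_ [_ [[_ H]|[H _]]]]|[H _]]; [congruence|contradiction|].
        destruct Ey. contradiction. }
      (* By agreement along the branch, [phi (top y)] would take the value [height w] at both
         heights. *)
      destruct L as [L A]. apply (walk_code_inj _ _ _ L (height_top y)).
      rewrite <- Hy, Hx. symmetry. apply A. now right.
    - specialize (Hc0 (height y) I). specialize (HSlt (height y)). ord.
    - specialize (Hc0 (height x) I). specialize (HSlt (height x)). ord.
    - apply HSi in Ec. destruct L as [L _]. ord. }
  intros x Fx. split.
  - destruct (excluded_middle_informative (E (height x))) as [Ex|Ex].
    + specialize (Hc0 n I). pose proof (HSlt n). pose proof (HSlt (S n)). ord.
    + assert (L : height x <= n).
      { destruct (Hf x) as [[_ [_ [[H _]|[_ H]]]]|[_ H]]; [contradiction| |].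
        - apply H; [exact En|]. now rewrite Fx.
        - left. rewrite <- H, Fx. exact Ln. }
      destruct L as [L| ->]; [|apply HSlt].
      apply HS in L. pose proof (HSlt n). pose proof (HSlt (S n)). ord.
  - intros y Fy Ec n0. split; [now apply Main|]. apply Main; auto.
Qed.

End Walks.

Lemma square_lt_special_tree : square_star_lt lt -> exists_special_aronszajn lt.
Proof.
  intros [C [HC [HW HR]]].
  destruct (next_exists HC) as [next Hnext]. destruct (otp_exists (C := C)) as [ot Hot].
  destruct K_pairing as [z [pr [prz pri]]].
  destruct (walk_code_exists (ot := ot) (pr := pr) (z := z) Hnext) as [phi Hphi].
  pose proof (node_tree Hnext Hot Hphi HW) as HT.
  pose proof (node_special Hnext Hot prz pri Hphi HR) as HS.
  exists (node (phi := phi)), node_lt, height. split; [exact HT|].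
  split; [exact (special_aronszajn HT HS)|exact HS].
Qed.

(** * A weak square sequence from a special tree *)

Lemma limit_pt_ext (A B : K -> Prop) y :
  (forall x, x < y -> A x -> B x) -> limit_pt lt A y -> limit_pt lt B y.
Proof.
  intros H [H1 H2]. split; [exact H1|]. intros c Hc.
  destruct (H2 c Hc) as [a [Ha [L L']]]. eauto.
Qed.

Lemma small_single {X : Type} (a : X) : small (fun x => x = a).
Proof.
  destruct two_below_mu as [u [_ [Hu _]]]. exists (fun _ => u). split; [auto|].
  intros x y -> ->. reflexivity.
Qed.

Section Records.
Context {T : Type} {tlt : T -> T -> Prop} {h : T -> K}.
Context (HT : is_kappa_tree lt tlt h).
Context {g : T -> K} (gmu : forall x, g x < mu0).
Context (gtree : forall x y, tlt x y -> g x <> g y).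

Lemma tlt_trans x y w : tlt x y -> tlt y w -> tlt x w.
Proof. apply HT. Qed.
Lemma tlt_h x y : tlt x y -> h x < h y.
Proof. apply HT. Qed.
Lemma tlt_cmp t x y : tlt x t -> tlt y t -> x = y \/ tlt x y \/ tlt y x.
Proof. apply HT. Qed.
Lemma tlt_level t a : a < h t -> exists s, tlt s t /\ h s = a.
Proof. apply HT. Qed.

Lemma tlt_of_h t x y : tlt x t -> tlt y t -> h x < h y -> tlt x y.
Proof.
  intros Hx Hy L. destruct (tlt_cmp _ _ _ Hx Hy) as [->|[H|H]].
  - ord.
  - exact H.
  - apply tlt_h in H. ord.
Qed.

Definition record (t s : T) : Prop :=
  tlt s t /\ forall s', tlt s s' -> tlt s' t -> g s < g s'.

(** [m] is the node of [r, t) with the least value of [g]; it is a record because values along a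
    branch are distinct. *)
Lemma record_above t r : tlt r t -> exists m, record t m /\ (m = r \/ tlt r m) /\
  forall s, (s = r \/ tlt r s) -> tlt s t -> g m <= g s.
Proof.
  intro Hr.
  destruct (least (fun k => exists s, (s = r \/ tlt r s) /\ tlt s t /\ g s = k))
    as [k [[m [Hm [Hmt <-]]] Hk]]; [exists (g r), r; auto|].
  exists m. split; [|split; eauto]. split; [exact Hmt|]. intros s' H H'.
  assert (g m <= g s').
  { apply Hk. exists s'. repeat split; auto. right.
    destruct Hm as [->|Hm]; [exact H|exact (tlt_trans _ _ _ Hm H)]. }
  pose proof (gtree _ _ H). ord.
Qed.

(** A record of [r] remains a record of [t] exactly when its value is below the minimum [g m] of [g]
    on [r, t). *)
Lemma record_restrict t r : tlt r t -> exists m, tlt m t /\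
  forall s, tlt s r -> (record t s <-> record r s /\ g s < g m).
Proof.
  intro Hr. destruct (record_above t r Hr) as [m [[Hm _] [Hrm Hmin]]].
  exists m. split; [exact Hm|]. intros s Hs. split.
  - intros [H1 H2]. split.
    + split; [exact Hs|]. intros s' H H'. apply H2; [exact H|].
      exact (tlt_trans _ _ _ H' Hr).
    + apply H2; [|exact Hm]. destruct Hrm as [->|Hrm]; [exact Hs|].
      exact (tlt_trans _ _ _ Hs Hrm).
  - intros [[_ H1] H2]. split; [exact (tlt_trans _ _ _ Hs Hr)|]. intros s' H H'.
    destruct (tlt_cmp _ _ _ H' Hr) as [->|[L|L]].
    + specialize (Hmin r (or_introl eq_refl) Hr). ord.
    + auto.
    + specialize (Hmin s' (or_intror L) H'). ord.
Qed.

(** The tag is the least strict upper bound. It may equal [mu0], so tags range over [cseg mu0]. *)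
Lemma record_sup_exists : exists sg : T -> K, forall t,
  (forall s, record t s -> g s < sg t) /\ sg t <= mu0 /\
  forall c, (forall s, record t s -> g s < c) -> sg t <= c.
Proof.
  apply (choice (fun t c0 => (forall s, record t s -> g s < c0) /\ c0 <= mu0 /\
    forall c, (forall s, record t s -> g s < c) -> c0 <= c)). intro t.
  destruct (least (fun c => forall s, record t s -> g s < c)) as [c [H1 H2]]; [eauto|].
  exists c. split; [exact H1|]. split; auto.
Qed.

(** Only nodes of equal height need distinct codes, since the block number in [code] will record the
    height. *)
Lemma node_code_exists : exists e : T -> K -> K,
  (forall s c, c <= mu0 -> e s c < mu0) /\
  forall s s' c c', h s = h s' -> c <= mu0 -> c' <= mu0 -> e s c = e s' c' ->
    s = s' /\ c = c'.
Proof.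
  destruct mu_pairing as [z [pr [_ [pr1 pr2]]]].
  destruct (small_cseg mu0) as [i [i1 i2]].
  destruct (choice (fun a (f : T -> K) => (forall t, h t = a -> f t < mu0) /\
    forall s t, h s = a -> h t = a -> f s = f t -> s = t)) as [f Hf].
  { intro a. destruct HT as [_ [_ [_ [_ [_ [_ H]]]]]]. destruct (H a) as [b Hb].
    destruct (inj_trans _ _ _ Hb (seg_inj_mu b)) as [f Hf]. exists f. exact Hf. }
  assert (Hfm : forall s, f (h s) s < mu0) by (intro s; now apply Hf).
  exists (fun s c => pr (f (h s) s) (i c)). split.
  - intros s c Hc. apply pr1; auto.
  - intros s s' c c' E Hc Hc' E'. apply pr2 in E'; auto. destruct E' as [E1 E2].
    split; [|now apply i2]. rewrite <- E in E1. now apply (Hf (h s)).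
Qed.

(** * Coding tagged records by ordinals, and the resulting sequence *)

Context {G : K -> K -> K} {pi rho : K -> K}.
Context (rho_mu : forall k, rho k < mu0).
Context (piG : forall a x, x < mu0 -> pi (G a x) = a /\ rho (G a x) = x).
Context (Hlex : forall k l, k < l <-> pi k < pi l \/ pi k = pi l /\ rho k < rho l).
Context {nd : K -> T} (Hnd : forall a, h (nd a) = a).
Context {sg : T -> K} (Hsg : forall t, (forall s, record t s -> g s < sg t) /\
  sg t <= mu0 /\ forall c, (forall s, record t s -> g s < c) -> sg t <= c).
Context {e : T -> K -> K} (e_mu : forall s c, c <= mu0 -> e s c < mu0).
Context (e_inj : forall s s' c c', h s = h s' -> c <= mu0 -> c' <= mu0 ->
  e s c = e s' c' -> s = s' /\ c = c').

Lemma sg_mu t : sg t <= mu0.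
Proof. exact (proj1 (proj2 (Hsg t))). Qed.

Lemma pi_lt k l : pi k < pi l -> k < l.
Proof. intro H. apply Hlex. now left. Qed.

Lemma pi_le k l : k <= l -> pi k <= pi l.
Proof.
  intro H. apply NNPP. intro N. apply not_le in N. apply pi_lt in N. ord.
Qed.

(** The ordinal mu * h s + e s c. *)
Definition code (s : T) (c : K) : K := G (h s) (e s c).

Lemma pi_code s c : c <= mu0 -> pi (code s c) = h s.
Proof. intro H. now apply piG, e_mu. Qed.

Lemma code_inj s s' c c' : c <= mu0 -> c' <= mu0 -> code s c = code s' c' ->
  s = s' /\ c = c'.
Proof.
  intros Hc Hc' E.
  assert (Eh : h s = h s') by now rewrite <- (pi_code s c), E, pi_code.
  apply e_inj; auto. unfold code in E.
  rewrite <- (proj2 (piG (h s) _ (e_mu s c Hc))), E. now apply piG, e_mu.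
Qed.

Definition code_set (t : T) (y : K) : Prop := exists s, record t s /\ y = code s (sg t).

Lemma code_set_lt t y : code_set t y -> pi y < h t.
Proof.
  intros [s [[Hs _] ->]]. rewrite pi_code; [now apply tlt_h|]. apply sg_mu.
Qed.

Lemma code_lt_tlt t s s' : record t s -> record t s' ->
  code s (sg t) < code s' (sg t) -> g s < g s'.
Proof.
  intros Hs Hs' L. apply Hs; [|apply Hs'].
  destruct (tlt_cmp t s s') as [->|[H|H]]; [apply Hs|apply Hs'| |exact H|].
  - ord.
  - apply tlt_h in H. rewrite <- (pi_code s (sg t)), <- (pi_code s' (sg t)) in H;
      [|apply sg_mu..]. apply pi_lt in H. ord.
Qed.

(* [d] is a limit of multiples of mu. *)
Definition block_limit (d : K) : Prop :=
  (exists c, c < d) /\ forall y, y < d -> exists w, w < d /\ pi y < pi w.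

(** At a block limit this is the closure in [d] of the codes for the chosen node of height [pi d].
    Any other nonzero [d] has a last block, and the part of it below [d] is taken, of order type at
    most mu. *)
Definition square_seq (d y : K) : Prop := y < d /\
  (block_limit d /\ (code_set (nd (pi d)) y \/ limit_pt lt (code_set (nd (pi d))) y) \/
   ~ block_limit d /\ forall w, w < d -> pi w <= pi y).

Lemma block_limit_pi d y : block_limit d -> y < d -> pi y < pi d.
Proof.
  intros [_ H] Hy. destruct (H y Hy) as [w [Hw L]].
  assert (pi w <= pi d) by (apply pi_le; now left). ord.
Qed.

Lemma code_set_lt_d d y : code_set (nd (pi d)) y -> y < d.
Proof. intro H. apply code_set_lt in H. rewrite Hnd in H. now apply pi_lt. Qed.

Lemma code_set_cofinal d y : block_limit d -> y < d ->
  exists s, record (nd (pi d)) s /\ y < code s (sg (nd (pi d))).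
Proof.
  intros Hd Hy. destruct Hd as [H0 H]. destruct (H y Hy) as [w [Hw L]].
  assert (L' : pi w < h (nd (pi d))).
  { rewrite Hnd. apply block_limit_pi; [now split|exact Hw]. }
  destruct (tlt_level _ _ L') as [r [Hr Er]].
  destruct (record_above _ _ Hr) as [m [Hm [Hrm _]]].
  exists m. split; [exact Hm|]. apply pi_lt. rewrite pi_code; [|apply sg_mu].
  assert (h r <= h m); [|ord]. destruct Hrm as [->|Hrm]; [now right|].
  left. now apply tlt_h.
Qed.

Lemma square_seq_Cseq : is_Cseq lt square_seq.
Proof.
  intro d. split; [|split].
  - now intros y [H _].
  - intros b Hb Hl. split; [exact Hb|].
    destruct (classic (block_limit d)) as [Hd|Hd]; [left|right]; split; auto.
    + right. destruct Hl as [H0 H]. split; [exact H0|]. intros c Hc.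
      destruct (H c Hc) as [y [[_ [[_ [Hy|Hy]]|[N _]]] [L L']]]; [eauto| |contradiction].
      destruct Hy as [_ Hy]. destruct (Hy c L) as [a [Ha [M M']]].
      exists a. repeat split; auto. ord.
    + intros w Hw. destruct Hl as [[c Hc] H].
      destruct (H c Hc) as [y [[_ [[N _]|[_ Hy]]] [L L']]]; [contradiction|].
      specialize (Hy w Hw). assert (pi y <= pi b) by (apply pi_le; now left). ord.
  - intros b Hb. destruct (classic (block_limit d)) as [Hd|Hd].
    + destruct (code_set_cofinal d b Hd Hb) as [s [Hs L]].
      assert (Cs : code_set (nd (pi d)) (code s (sg (nd (pi d))))) by (now exists s).
      exists (code s (sg (nd (pi d)))). split; [|now left].
      split; [now apply code_set_lt_d|]. left. auto.
    + assert (Hy : exists y, y < d /\ forall w, w < d -> pi w <= pi y).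
      { apply NNPP. intro N. apply Hd. split; [eauto|]. intros y Hy. apply NNPP.
        intro M. apply N. exists y. split; [exact Hy|]. intros w Hw. apply NNPP.
        intro L. apply M. exists w. split; [exact Hw|]. ord. }
      destruct Hy as [y [Hy H]].
      destruct (classic (b <= y)) as [L|L].
      * exists y. split; [|exact L]. split; auto.
      * exists b. split; [|now right]. split; [exact Hb|]. right. split; [exact Hd|].
        intros w Hw. specialize (H w Hw).
        assert (pi y <= pi b) by (apply pi_le; ord). ord.
Qed.

Lemma square_seq_otp d : otp_le lt (square_seq d) mu0.
Proof.
  destruct (classic (block_limit d)) as [Hd|Hd].
  - set (t := nd (pi d)).
    (* [f y] is the least strict bound on [g] over the records coded up to [y], hence at most the
       value at any later record. It grows because (x, y] contains the code of a record whenever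
       [x < y] and [y] is in the closure. *)
    destruct (choice (fun y k => (forall s, record t s -> code s (sg t) <= y -> g s < k) /\
      forall k', (forall s, record t s -> code s (sg t) <= y -> g s < k') -> k <= k'))
      as [f Hf].
    { intro y. apply least. eauto. }
    assert (Hfg : forall y s, record t s -> y < code s (sg t) -> f y <= g s).
    { intros y s Hs L. apply Hf. intros s' Hs' L'. apply (code_lt_tlt t); auto. ord. }
    exists f. split.
    + intros y [Hy _]. destruct (code_set_cofinal d y Hd Hy) as [s [Hs L]].
      specialize (Hfg y s Hs L). specialize (gmu s). ord.
    + intros x y _ [_ [[_ Hy]|[N _]]] L; [|contradiction].
      assert (M : exists s, record t s /\ x < code s (sg t) /\ code s (sg t) <= y).
      { destruct Hy as [[s [Hs ->]]|[_ Hy]].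
        - exists s. repeat split; auto; try apply Hs. now right.
        - destruct (Hy x L) as [a [[s [Hs ->]] [M M']]]. exists s.
          repeat split; auto; try apply Hs. now left. }
      destruct M as [s [Hs [M M']]]. specialize (Hfg x s Hs M).
      destruct (Hf y) as [H _]. specialize (H s Hs M'). ord.
  - exists rho. split; [auto|]. intros x y [Hx [[N _]|[_ Hm]]] [Hy _] L; [contradiction|].
    specialize (Hm y Hy). apply Hlex in L. destruct L as [L|[_ L]]; [|exact L]. ord.
Qed.

(* Above a node [r] the set of records below [r] is cut at a single value of [g], so
   the trace on [x] of [square_seq d] depends on few parameters. *)
Lemma square_seq_coherent : weakly_coherent lt square_seq.
Proof.
  apply small_weakly_coherent. intro x. destruct succ_exists as [S HS].
  pose (cut := fun (p : T * (K * K)) y =>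
    exists s, record (fst p) s /\ g s < fst (snd p) /\ y = code s (snd (snd p))).
  pose (level := prod_set (fun r : T => h r = S (pi x)) (prod_set (seg mu0) (cseg mu0))).
  (* The possible traces: those with [d <= x], the two left by a last block, and those given by a
     node [r], a bound on [g] and a tag. *)
  assert (Sm : small (fun A : K -> Prop =>
    (exists d, d <= x /\ (fun y => square_seq d y /\ y < x) = A) \/
    ((A = (fun y => False) \/ A = (fun y => pi y = pi x /\ y < x)) \/
     exists p, level p /\ (fun y => (cut p y \/ limit_pt lt (cut p) y) /\ y < x) = A))).
  { apply small_union; [apply small_image; [exact (inhabits x)|apply small_cseg]|].
    apply small_union; [apply small_union; apply small_single|].
    apply small_image; [exact (inhabits (nd x, (x, x)))|].
    apply small_prod; [|apply small_prod; [apply seg_inj_mu|apply small_cseg]].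
    destruct HT as [_ [_ [_ [_ [_ [_ H]]]]]]. destruct (H (S (pi x))) as [b Hb].
    exact (inj_trans _ _ _ Hb (seg_inj_mu b)). }
  eapply small_sub; [|exact Sm]. intros A [d ->].
  destruct (classic (d <= x)) as [Hx|Hx]; [left; eauto|right].
  apply not_le in Hx. destruct (classic (block_limit d)) as [Hd|Hd].
  - right. destruct Hd as [H0 H]. destruct (H x Hx) as [w [Hw L]].
    assert (Hd : block_limit d) by (now split).
    set (t := nd (pi d)).
    assert (L' : S (pi x) < h t).
    { unfold t. rewrite Hnd. apply HS in L. pose proof (block_limit_pi d w Hd Hw). ord. }
    (* Height [S (pi x)] puts every record coded below [x] strictly below [r]. *)
    destruct (tlt_level _ _ L') as [r [Hr Er]].
    destruct (record_restrict _ _ Hr) as [m [_ Hm]].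
    exists (r, (g m, sg t)). split.
    { split; [exact Er|]. split; [apply gmu|apply sg_mu]. }
    assert (Cut : forall y, y < x -> (code_set t y <-> cut (r, (g m, sg t)) y)).
    { intros y Hy. split.
      - intros [s [Hs ->]]. exists s. cbn.
        assert (Lsr : tlt s r).
        { apply (tlt_of_h t); auto; [apply Hs|].
          assert (M : pi (code s (sg t)) <= pi x) by (apply pi_le; now left).
          rewrite pi_code in M by apply sg_mu.
          assert (pi x < S (pi x)) by (apply HS; now right). ord. }
        destruct (proj1 (Hm s Lsr) Hs). auto.
      - intros [s [H1 [H2 ->]]]. cbn in *. exists s. split; [|reflexivity].
        apply Hm; [apply H1|now split]. }
    extensionality y. apply propositional_extensionality. split.
    + intros [H1 Hy]. split; [|exact Hy]. split; [ord|]. left. split; [exact Hd|].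
      destruct H1 as [H1|H1]; [left; now apply Cut|right].
      eapply limit_pt_ext; [|exact H1]. intros k Hk. apply Cut. ord.
    + intros [[_ [[_ H1]|[N _]]] Hy]; [|contradiction]. split; [|exact Hy].
      destruct H1 as [H1|H1]; [left; now apply Cut|right].
      eapply limit_pt_ext; [|exact H1]. intros k Hk. apply Cut. ord.
  - left. destruct (classic (exists y, square_seq d y /\ y < x)) as [[y0 [Hy0 L0]]|N].
    + right. extensionality y. apply propositional_extensionality.
      destruct Hy0 as [_ [[N _]|[_ Hy0]]]; [contradiction|].
      (* Since [y0 < x < d] and [y0] is in the last block below [d], so is [x]. *)
      assert (pi y0 <= pi x) by (apply pi_le; now left).
      split.
      * intros [[_ [[N _]|[_ Hw]]] Hy]; [contradiction|]. split; [|exact Hy].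
        specialize (Hw x Hx). assert (pi y <= pi x) by (apply pi_le; now left). ord.
      * intros [E Hy]. split; [|exact Hy]. split; [ord|]. right. split; [exact Hd|].
        intros w Hw. specialize (Hy0 w Hw). ord.
    + left. extensionality y. apply propositional_extensionality. split; [|tauto].
      intro. apply N. eauto.
Qed.

Lemma block_limit_club : club lt block_limit.
Proof.
  split.
  - intro a. destruct (choice (fun x w => pi x < pi w)) as [F HF].
    { intro x. destruct (no_max (pi x)) as [b Hb]. exists (G b (rho x)).
      now rewrite (proj1 (piG b _ (rho_mu x))). }
    destruct (closure_point F a) as [d [Ha Hd]]. exists d. split; [|now left].
    split; [eauto|]. intros y Hy. exists (F y). auto.
  - intros b [H0 H]. split; [exact H0|]. intros y Hy.
    destruct (H y Hy) as [d [[_ Hd] [L L']]]. destruct (Hd y L) as [w [Hw M]].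
    exists w. split; [ord|exact M].
Qed.

(* If the branch below [t] is contained in that below [u] and the records of [u] are
   unbounded in it, then a record of [u] above it has a larger value than all records of
   [t], so that [sg t < sg u]. *)
Lemma common_records_bounded t u : h t < h u -> (exists s, tlt s t) -> sg t = sg u ->
  exists s0, tlt s0 t /\ forall s, record t s -> record u s -> h s <= h s0.
Proof.
  intros L [s1 Hs1] E.
  destruct (classic (exists s0, tlt s0 t /\ ~ tlt s0 u)) as [[s0 [H0 N0]]|N].
  - exists s0. split; [exact H0|]. intros s [Hs _] [Hs' _].
    destruct (tlt_cmp _ _ _ Hs H0) as [->|[M|M]]; [now right|left; now apply tlt_h|].
    exfalso. apply N0. exact (tlt_trans _ _ _ M Hs').
  - destruct (tlt_level _ _ L) as [r [Hr Er]].
    destruct (record_above _ _ Hr) as [m [Hm [Hrm _]]].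
    assert (Lm : h t <= h m).
    { rewrite <- Er. destruct Hrm as [->|Hrm]; [now right|]. left. now apply tlt_h. }
    assert (H0 : exists s0, record t s0 /\ g m <= g s0).
    { apply NNPP. intro M. assert (H : sg t <= g m).
      { apply Hsg. intros s Hs. apply NNPP. intro. apply M. exists s.
        split; [exact Hs|]. ord. }
      pose proof (proj1 (Hsg u) m Hm). ord. }
    destruct H0 as [s0 [H0 M0]]. exists s0. split; [apply H0|]. intros s Hs Hs'.
    destruct (tlt_cmp t s s0) as [->|[M|M]];
      [apply Hs|apply H0|now right|left; now apply tlt_h|].
    (* A common record [s] above [s0] would have [g s > g s0 >= g m], yet [g s < g m] as a record of
       [u] below [m]. *)
    exfalso. assert (g s0 < g s) by (apply H0; [exact M|apply Hs]).
    assert (g s < g m); [|ord]. apply Hs'; [|apply Hm].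
    apply (tlt_of_h u); [apply Hs'|apply Hm|].
    assert (h s < h t) by (apply tlt_h, Hs). ord.
Qed.

(** A limit of codes is a limit of points of the sequence itself, so [nacc] retains only codes. *)
Lemma nacc_code d x : block_limit d -> nacc lt (square_seq d) x -> code_set (nd (pi d)) x.
Proof.
  intros Hd [[Hx [[_ [H|H]]|[N _]]] Hl]; [exact H| |contradiction].
  exfalso. apply Hl. eapply limit_pt_ext; [|exact H].
  intros y Hy Cy. split; [ord|]. left. auto.
Qed.

Lemma square_seq_Vprime d : block_limit d -> Vprime lt square_seq d.
Proof.
  intro Hd. pose proof Hd as [[c0 Hc0] H]. split.
  - split; [eauto|]. intros c Hc. destruct (H c Hc) as [w [Hw L]]. exists w.
    split; [exact I|]. split; [now apply pi_lt|exact Hw].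
  - intros a La. destruct (classic (block_limit a)) as [Ha|Ha].
    + pose proof (block_limit_pi a d Ha La) as Lp.
      pose proof (block_limit_pi d c0 Hd Hc0) as L0.
      set (t := nd (pi d)). set (u := nd (pi a)).
      assert (Cm : exists s0, tlt s0 t /\ (sg t = sg u -> forall s,
        record t s -> record u s -> h s <= h s0)).
      { destruct (tlt_level t (pi c0)) as [s1 [Hs1 _]]; [unfold t; now rewrite Hnd|].
        destruct (classic (sg t = sg u)) as [E|E].
        - destruct (common_records_bounded t u) as [s0 [H1 H2]]; eauto.
          unfold t, u. now rewrite !Hnd.
        - exists s1. tauto. }
      destruct Cm as [s0 [Hs0 Cm]].
      (* [rho d] is merely some offset below mu. A point [w] of a later block bounds all codes of
         records of height at most [h s0]. *)
      assert (Lz : G (h s0) (rho d) < d).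
      { apply pi_lt. rewrite (proj1 (piG _ _ (rho_mu d))).
        apply tlt_h in Hs0. unfold t in Hs0. now rewrite Hnd in Hs0. }
      destruct (H _ Lz) as [w [Hw Lw]]. rewrite (proj1 (piG _ _ (rho_mu d))) in Lw.
      exists w. split; [exact Hw|]. intros x Hx Hx'.
      apply nacc_code in Hx; [|exact Hd]. apply nacc_code in Hx'; [|exact Ha].
      fold t in Hx. fold u in Hx'. destruct Hx as [s [Hs ->]], Hx' as [s' [Hs' E]].
      apply code_inj in E; [|apply sg_mu..]. destruct E as [<- E].
      specialize (Cm E s Hs Hs'). left. apply pi_lt. rewrite pi_code by apply sg_mu. ord.
    (* Here C_a lies in the last block below [a], while every [x < d] has a later block below [d],
       so there are no common points and any bound serves. *)
    + exists c0. split; [exact Hc0|]. intros x [[Hx _] _] [[_ [[N _]|[_ Hx']]] _];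
        [contradiction|].
      destruct (H x Hx) as [w [Hw L]].
      assert (M : pi w <= pi x) by (apply Hx'; ord). ord.
Qed.

End Records.

Lemma special_tree_square : exists_special_aronszajn lt ->
  exists C, square_star_seq lt mu0 C /\ contains_club lt (Vprime lt C).
Proof.
  intros [T [tlt [h [HT [_ Hs]]]]].
  destruct (special_coloring HT Hs) as [g [g1 g2]].
  destruct blocks as [G [pi [rho [Gpi [rmu [piG Hlex]]]]]].
  destruct (choice (fun a t => h t = a)) as [nd Hnd]; [apply HT|].
  destruct (record_sup_exists (tlt := tlt) g1) as [sg Hsg].
  destruct (node_code_exists HT) as [e [e1 e2]].
  exists (square_seq (tlt := tlt) (h := h) (g := g) (G := G) (pi := pi) (nd := nd)
            (sg := sg) (e := e)).
  split; [split; [|split]|].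
  - eapply square_seq_Cseq; eauto.
  - eapply square_seq_coherent; eauto.
  - intro d. eapply square_seq_otp; eauto.
  - exists (block_limit (pi := pi)). split.
    + eapply block_limit_club; eauto.
    + intros d Hd. eapply square_seq_Vprime; eauto.
Qed.

Lemma square_star_square_lt C : square_star_seq lt mu0 C -> square_star_lt lt.
Proof.
  intros [HC [HW HO]]. exists C. split; [exact HC|]. split; [exact HW|].
  (* For limits [d] above [mu0], the bound [mu0] on all order types is itself below [d]. *)
  exists (fun d => mu0 < d /\ acc_kappa lt d). split; [split|].
  - intro a. destruct succ_exists as [S HS].
    assert (HSl : forall x, x < S x) by (intro x; apply HS; now right).
    destruct (small_bounded _ (small_union _ _ (small_cseg a) (small_cseg mu0)))
      as [b Hb].
    destruct (closure_point S b) as [d [Hbd Hd]].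
    assert (a < b) by (apply Hb; left; now right).
    assert (mu0 < b) by (apply Hb; right; now right).
    exists d. split; [|ord]. split; [ord|]. split; [eauto|]. intros c Hc.
    exists (S c). auto.
  - intros b [H0 H]. split.
    + destruct H0 as [c Hc]. destruct (H c Hc) as [d [[L _] [_ M]]]. ord.
    + split; [exact H0|]. intros c Hc. destruct (H c Hc) as [d [_ L]]. eauto.
  - intros d [L Hd]. split; [exact Hd|]. intros a _. exists mu0. split; [exact L|].
    destruct (HO a) as [f [f1 f2]]. exists f. split; [|intros x y [Hx _] [Hy _]; auto].
    intros x [Hx _]. auto.
Qed.

End Cardinals.

Theorem theorem10p2 (K : Type) (lt : K -> K -> Prop) (mu0 : K) :
  is_succ_card lt mu0 ->
  ((exists C, square_star_seq lt mu0 C /\ contains_club lt (Vprime lt C))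
     <-> square_star_lt lt) /\
  (square_star_lt lt <-> exists_special_aronszajn lt).
Proof.
  intro HK. split; split.
  - intros [C [HC _]]. exact (square_star_square_lt HK C HC).
  - intro H. apply (special_tree_square HK), (square_lt_special_tree HK H).
  - exact (square_lt_special_tree HK).
  - intro H. destruct (special_tree_square HK H) as [C [HC _]].
    exact (square_star_square_lt HK C HC).
Qed.
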